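(* Let $\mathcal{S}_s$ be the category of signatures and strict morphisms and $\mathcal{S}_f$ the category of signatures and flexible morphisms, let $(+):\mathcal{S}_s\to\mathcal{S}_f$ and $(-):\mathcal{S}_f\to\mathcal{S}_s$ be the (faithful) functors defined in the context, and let $\eta:\mathrm{Id}_{\mathcal{S}_s}\to(-)\circ(+)$ and $\varepsilon:(+)\circ(-)\to\mathrm{Id}_{\mathcal{S}_f}$ be the natural transformations defined in the context. Then the functor $(+)$ is left adjoint to the functor $(-)$, and $\eta$ and $\varepsilon$ are, respectively, the unit and the counit of this adjunction.
   Context: Fix an enumerable set of variables $X=\{x_0,x_1,\dots\}$. A signature is a sequence of pairwise disjoint sets $\Sigma=(\Sigma_n)_{n\in\mathbb{N}}$ (elements of $\Sigma_n$ are the $n$-ary connectives). $F(\Sigma)$ is the set (absolutely free algebra) of all formulas over $\Sigma$ with variables in $X$; $\mathrm{var}(\varphi)$ is the set of variables occurring in $\varphi$; $F(\Sigma)[n]=\{\varphi\in F(\Sigma):\mathrm{var}(\varphi)=\{x_0,\dots,x_{n-1}\}\}$. $T(\Sigma):=(F(\Sigma)[n])_{n\in\mathbb{N}}$, which is again a signature. $(j_\Sigma)_n:\Sigma_n\to F(\Sigma)[n]$, $c_n\mapsto c_n(x_0,\dots,x_{n-1})$, so $j_\Sigma=((j_\Sigma)_n)_n:\Sigma\to T(\Sigma)$. $\mathcal{S}_s$: objects are signatures; a (strict) morphism $f:\Sigma\to\Sigma'$ is a sequence of functions $f_n:\Sigma_n\to\Sigma'_n$; composition and identities are componentwise. Its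 extension $\hat f:F(\Sigma)\to F(\Sigma')$ is given by $\hat f(x)=x$ for $x\in X$ and $\hat f(c_n(\psi_0,\dots,\psi_{n-1}))=f_n(c_n)(\hat f(\psi_0),\dots,\hat f(\psi_{n-1}))$. $\mathcal{S}_f$: objects are signatures; a (flexible) morphism $f:\Sigma\to\Sigma'$ is given by a strict morphism $f^\sharp:\Sigma\to T(\Sigma')$; for a strict $g:\Sigma\to T(\Sigma')$ write $g^\flat$ for the flexible morphism $\Sigma\to\Sigma'$ with $(g^\flat)^\sharp=g$. Its extension $\check f:F(\Sigma)\to F(\Sigma')$ is given by $\check f(x)=x$ for $x\in X$ and $\check f(c_n(\psi_0,\dots,\psi_{n-1}))=f^\sharp_n(c_n)[x_0\mid\check f(\psi_0),\dots,x_{n-1}\mid\check f(\psi_{n-1})]$ (simultaneous substitution); it restricts to maps $\check f\restriction_n:F(\Sigma)[n]\to F(\Sigma')[n]$. Composition: $(f'\bullet f)^\sharp_n=\check{f'}\restriction_n\circ f^\sharp_n$; identity: $(id_\Sigma)^\sharp=j_\Sigma$. Functors: $(+)$ is the identity on objects and sends $f:\Sigma\to\Sigma'$ to $f^+:=(j_{\Sigma'}\circ f)^\flat$; $(-)$ sends $\Sigma$ to $T(\Sigma)$ and $h:\Sigma\to\Sigma'$ to $h^-:=(\check h\restriction_n)_{n}:T(\Sigma)\to T(\Sigma')$. Natural transformations: $\eta_\Sigma:=j_\Sigma:\Sigma\to T(\Sigma)$ in $\mathcal{S}_s$; $\varepsilon_\Sigma:T(\Sigma)\to\Sigma$ is the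 morphism of $\mathcal{S}_f$ with $(\varepsilon_\Sigma)^\sharp_n=id_{F(\Sigma)[n]}$. *)

(* Defs.v *)
From mathcomp Require Import all_boot.
From mathcomp Require Import finmap.
From Stdlib Require Import FunctionalExtensionality.

Set Implicit Arguments.
Unset Strict Implicit.
Unset Printing Implicit Defensive.

Local Open Scope fset_scope.

Record category := Category {
  ob :> Type;
  hom : ob -> ob -> Type;
  idm : forall A, hom A A;
  comp : forall A B C, hom B C -> hom A B -> hom A C;
  comp1m : forall A B (f : hom A B), comp (idm B) f = f;
  compm1 : forall A B (f : hom A B), comp f (idm A) = f;
  compA : forall A B C D (h : hom C D) (g : hom B C) (f : hom A B),
    comp h (comp g f) = comp (comp h g) f
}.
Arguments hom {c} A B.
Arguments idm {c} A.
Arguments comp {c A B C} g f.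

Record functor (C D : category) := Functor {
  fobj :> C -> D;
  fmap : forall A B : C, hom A B -> hom (fobj A) (fobj B);
  fmap_id : forall A : C, fmap (idm A) = idm (fobj A);
  fmap_comp : forall (A B E : C) (g : hom B E) (f : hom A B),
    fmap (comp g f) = comp (fmap g) (fmap f)
}.
Arguments fmap {C D} f {A B} h : rename.

Definition faithful (C D : category) (F : functor C D) : Prop :=
  forall A B : C, injective (@fmap C D F A B).

Definition functor_id (C : category) : functor C C :=
  @Functor C C (fun A => A) (fun _ _ f => f)
    (fun _ => erefl) (fun _ _ _ _ _ => erefl).

Section FunctorComp.
Variables (C D E : category) (G : functor D E) (F : functor C D).

Lemma functor_comp_id (A : C) : fmap G (fmap F (idm A)) = idm (G (F A)).
Proof. by rewrite !fmap_id. Qed.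

Lemma functor_comp_comp (A B A' : C) (g : hom B A') (f : hom A B) :
  fmap G (fmap F (comp g f)) = comp (fmap G (fmap F g)) (fmap G (fmap F f)).
Proof. by rewrite !fmap_comp. Qed.

Definition functor_comp : functor C E :=
  @Functor C E (fun A => G (F A)) (fun _ _ f => fmap G (fmap F f))
    functor_comp_id functor_comp_comp.
End FunctorComp.

Record nat_trans (C D : category) (F G : functor C D) := NatTrans {
  component :> forall A : C, hom (F A) (G A);
  naturality : forall (A B : C) (f : hom A B),
    comp (component B) (fmap F f) = comp (fmap G f) (component A)
}.

(* Bijections hom (F A) B <-> hom A (G B), natural in A and in B. *)
Record adjunction (C D : category) (F : functor C D) (G : functor D C) :=
Adjunction {
  transpose : forall (A : C) (B : D), hom (F A) B -> hom A (G B);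
  untranspose : forall (A : C) (B : D), hom A (G B) -> hom (F A) B;
  transposeK : forall A B, cancel (@transpose A B) (@untranspose A B);
  untransposeK : forall A B, cancel (@untranspose A B) (@transpose A B);
  transpose_natl : forall (A' A : C) (B : D) (u : hom A' A) (f : hom (F A) B),
    transpose (comp f (fmap F u)) = comp (transpose f) u;
  transpose_natr : forall (A : C) (B B' : D) (v : hom B B') (f : hom (F A) B),
    transpose (comp v f) = comp (fmap G v) (transpose f)
}.

Definition adj_unit (C D : category) (F : functor C D) (G : functor D C)
    (adj : adjunction F G) (A : C) : hom A (G (F A)) :=
  transpose adj (idm (F A)).

Definition adj_counit (C D : category) (F : functor C D) (G : functor D C)
    (adj : adjunction F G) (B : D) : hom (F (G B)) B :=
  untranspose adj (idm (G B)).

(* [S n] is the set of n-ary connectives; these sets are disjoint by typing. *)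
Definition signature := nat -> Type.

Section Formulas.
Variable S : signature.

(* [Var i] is the variable x_i. *)
Inductive formula : Type :=
| Var of nat
| App n of S n & ('I_n -> formula).

Fixpoint var (phi : formula) : {fset nat} :=
  match phi with
  | Var i => [fset i]
  | App n _ psi => \big[fsetU/fset0]_(i < n) var (psi i)
  end.

(* F(S)[n] *)
Definition formula_in (n : nat) : Type :=
  {phi : formula | var phi == [fset i in iota 0 n]}.

Fixpoint subst (s : nat -> formula) (phi : formula) : formula :=
  match phi with
  | Var i => s i
  | App n c psi => App c (fun i => subst s (psi i))
  end.

(* [x_0 | psi_0, ..., x_(n-1) | psi_(n-1)]; other variables are fixed. *)
Definition assign n (psi : 'I_n -> formula) (i : nat) : formula :=
  if insub i is Some k then psi k else Var i.

End Formulas.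
Arguments Var {S} i : rename.
Arguments App {S n} c psi : rename.

Definition T (S : signature) : signature := formula_in S.

Lemma formula_in_eq (S : signature) n (a b : T S n) : sval a = sval b -> a = b.
Proof. exact: val_inj. Qed.

Lemma in_iota_fset n k : (k \in [fset i in iota 0 n]) = (k < n).
Proof. by rewrite !inE /= mem_iota. Qed.

Lemma in_var_App (S : signature) n (c : S n) psi k :
  reflect (exists i, k \in var (psi i)) (k \in var (App c psi)).
Proof.
apply: (iffP (bigfcupP _ _ _ _)) => [[i _ ki]|[i ki]]; first by exists i.
by exists i => //; rewrite mem_index_enum.
Qed.

Lemma in_var_subst (S : signature) (s : nat -> formula S) phi k :
  reflect (exists2 i, i \in var phi & k \in var (s i))
    (k \in var (subst s phi)).
Proof.
elim: phi => [i|n c psi IH] /=.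
  apply: (iffP idP) => [ks|[j]]; first by exists i; rewrite ?inE.
  by rewrite inE => /eqP->.
apply: (iffP (in_var_App c (fun i => subst s (psi i)) k)).
  by case=> i /IH[j ji kj]; exists j => //; apply/(in_var_App c); exists i.
case=> j /(in_var_App c psi)[i ji] kj; exists i; apply/IH; by exists j.
Qed.

Lemma assign_ord (S : signature) n (psi : 'I_n -> formula S) (i : 'I_n) :
  assign psi i = psi i.
Proof. by rewrite /assign valK. Qed.

Lemma var_subst_assign (S : signature) n (phi : T S n)
    (psi : 'I_n -> formula S) k :
  reflect (exists i, k \in var (psi i))
    (k \in var (subst (assign psi) (sval phi))).
Proof.
have vphi i : (i \in var (sval phi)) = (i < n).
  by rewrite (eqP (svalP phi)) in_iota_fset.
apply: (iffP (in_var_subst _ _ _)) => [[i]|[i ki]].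
  by rewrite vphi => lt_i; rewrite (assign_ord psi (Ordinal lt_i));
    exists (Ordinal lt_i).
by exists (nat_of_ord i); rewrite ?assign_ord // vphi.
Qed.

Definition strict (S S' : signature) : Type := forall n, S n -> S' n.

Definition strict_id (S : signature) : strict S S := fun n c => c.
Arguments strict_id : clear implicits.

Definition strict_comp (S S' S'' : signature)
    (g : strict S' S'') (f : strict S S') : strict S S'' :=
  fun n c => g n (f n c).

Definition Ss : category :=
  @Category signature strict strict_id strict_comp
    (fun _ _ _ => erefl) (fun _ _ _ => erefl) (fun _ _ _ _ _ _ _ => erefl).

Lemma strictP (S S' : signature) (f g : strict S S') :
  (forall n c, f n c = g n c) -> f = g.
Proof.
move=> fg; apply: functional_extensionality_dep => n.
exact: functional_extensionality_dep (fg n).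
Qed.

(* [Flat] and [sharp] are the mutually inverse g |-> g^flat, f |-> f^sharp. *)
Record flexible (S S' : signature) : Type := Flat {sharp : strict S (T S')}.

Fixpoint ext S S' (f : flexible S S') (phi : formula S) : formula S' :=
  match phi with
  | Var i => Var i
  | App n c psi => subst (assign (fun i => ext f (psi i))) (sval (sharp f c))
  end.

Lemma var_ext (S S' : signature) (f : flexible S S') phi :
  var (ext f phi) = var phi.
Proof.
elim: phi => [//|n c psi IH]; apply/fsetP => k.
apply: (sameP (var_subst_assign (sharp f c) (fun i => ext f (psi i)) k)).
by apply: (iffP (in_var_App c psi k)) => -[i ki]; exists i; rewrite IH in ki *.
Qed.

Lemma ext_in (S S' : signature) (f : flexible S S') n (phi : T S n) :
  var (ext f (sval phi)) == [fset i in iota 0 n].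
Proof. by rewrite var_ext; exact: (svalP phi). Qed.

Definition ext_restr S S' (f : flexible S S') : strict (T S) (T S') :=
  fun n phi => exist _ (ext f (sval phi)) (ext_in f phi).

Lemma j_in (S : signature) n (c : S n) :
  var (App c (fun i : 'I_n => Var i)) == [fset i in iota 0 n].
Proof.
apply/eqP/fsetP => k; rewrite in_iota_fset.
apply/in_var_App/idP => [[i]|ltkn]; first by rewrite inE => /eqP->.
by exists (Ordinal ltkn); rewrite inE.
Qed.

Definition j (S : signature) : strict S (T S) :=
  fun n c => exist _ (App c (fun i : 'I_n => Var i)) (j_in c).

Definition flex_id (S : signature) : flexible S S := Flat (@j S).

Definition flex_comp (S S' S'' : signature)
    (f' : flexible S' S'') (f : flexible S S') : flexible S S'' :=
  Flat (fun n c => ext_restr f' (sharp f c)).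

Lemma flexP (S S' : signature) (f g : flexible S S') :
  (forall n (c : S n), sval (sharp f c) = sval (sharp g c)) -> f = g.
Proof.
case: f g => [f] [g] /= fg; congr Flat; apply: strictP => n c.
exact/formula_in_eq/fg.
Qed.

Lemma eq_App (S : signature) n (c : S n) psi psi' :
  psi =1 psi' -> App c psi = App c psi'.
Proof. by move=> e; congr App; exact: functional_extensionality. Qed.

Lemma eq_in_subst (S : signature) (s s' : nat -> formula S) phi :
  {in var phi, s =1 s'} -> subst s phi = subst s' phi.
Proof.
elim: phi => [i|n c psi IH] e /=; first by apply: e; rewrite inE.
apply: eq_App => i; apply: IH => k ki; apply: e.
by apply/in_var_App; exists i.
Qed.

Lemma subst_Var (S : signature) (phi : formula S) : subst Var phi = phi.
Proof. by elim: phi => // n c psi IH /=; exact: eq_App. Qed.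

Lemma subst_subst (S : signature) (s s' : nat -> formula S) phi :
  subst s' (subst s phi) = subst (fun i => subst s' (s i)) phi.
Proof. by elim: phi => // n c psi IH /=; exact: eq_App. Qed.

Lemma eq_in_T (S : signature) n (s s' : nat -> formula S) (phi : T S n) :
  (forall i : 'I_n, s i = s' i) -> subst s (sval phi) = subst s' (sval phi).
Proof.
move=> e; apply: eq_in_subst => i.
rewrite (eqP (svalP phi)) in_iota_fset => lt_i; exact: (e (Ordinal lt_i)).
Qed.

Lemma subst_assign_Var (S : signature) n (phi : T S n) :
  subst (assign (fun i : 'I_n => Var i)) (sval phi) = sval phi.
Proof. by rewrite -[RHS]subst_Var; apply: eq_in_T => i; rewrite assign_ord. Qed.

Lemma ext_subst (S S' : signature) (f : flexible S S') s phi :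
  ext f (subst s phi) = subst (fun i => ext f (s i)) (ext f phi).
Proof.
elim: phi => // n c psi IH /=; rewrite subst_subst.
by apply: eq_in_T => i; rewrite !assign_ord IH.
Qed.

Lemma ext_id (S : signature) (phi : formula S) : ext (flex_id S) phi = phi.
Proof.
by elim: phi => // n c psi IH /=; apply: eq_App => i; rewrite assign_ord IH.
Qed.

Lemma ext_j (S S' : signature) (f : flexible S S') n (c : S n) :
  ext f (sval (j c)) = sval (sharp f c).
Proof. exact: subst_assign_Var. Qed.

Lemma ext_comp (S S' S'' : signature) (f' : flexible S' S'')
    (f : flexible S S') phi :
  ext (flex_comp f' f) phi = ext f' (ext f phi).
Proof.
elim: phi => // n c psi IH /=; rewrite ext_subst.
apply: (@eq_in_T _ _ _ _ (ext_restr f' (sharp f c))) => i.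
by rewrite !assign_ord IH.
Qed.

Lemma flex_comp1m (S S' : signature) (f : flexible S S') :
  flex_comp (flex_id S') f = f.
Proof. by apply: flexP => n c; exact: ext_id. Qed.

Lemma flex_compm1 (S S' : signature) (f : flexible S S') :
  flex_comp f (flex_id S) = f.
Proof. by apply: flexP => n c; exact: ext_j. Qed.

Lemma flex_compA (S0 S1 S2 S3 : signature) (h : flexible S2 S3)
    (g : flexible S1 S2) (f : flexible S0 S1) :
  flex_comp h (flex_comp g f) = flex_comp (flex_comp h g) f.
Proof. by apply: flexP => n c; rewrite /= ext_comp. Qed.

Definition Sf : category :=
  @Category signature flexible flex_id flex_comp
    flex_comp1m flex_compm1 flex_compA.

Definition plus_map (S S' : signature) (f : strict S S') : flexible S S' :=
  Flat (strict_comp (@j S') f).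

Lemma plus_id (S : signature) : plus_map (strict_id S) = flex_id S.
Proof. by []. Qed.

Lemma plus_comp (S S' S'' : signature) (g : strict S' S'') (f : strict S S') :
  plus_map (strict_comp g f) = flex_comp (plus_map g) (plus_map f).
Proof. apply: flexP => n c; exact: esym (ext_j (plus_map g) (f n c)). Qed.

Definition plus : functor Ss Sf :=
  @Functor Ss Sf (fun S => S) plus_map plus_id plus_comp.

Lemma minus_id (S : signature) : ext_restr (flex_id S) = strict_id (T S).
Proof. by apply: strictP => n c; apply: formula_in_eq; exact: ext_id. Qed.

Lemma minus_comp (S S' S'' : signature)
    (g : flexible S' S'') (f : flexible S S') :
  ext_restr (flex_comp g f) = strict_comp (ext_restr g) (ext_restr f).
Proof. by apply: strictP => n c; apply: formula_in_eq; exact: ext_comp. Qed.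

Definition minus : functor Sf Ss :=
  @Functor Sf Ss T ext_restr minus_id minus_comp.

Lemma eta_natural (S S' : signature) (f : strict S S') :
  strict_comp (@j S') f = strict_comp (ext_restr (plus_map f)) (@j S).
Proof.
apply: strictP => n c; apply: formula_in_eq.
exact: esym (ext_j (plus_map f) c).
Qed.

Definition eta : nat_trans (functor_id Ss) (functor_comp minus plus) :=
  @NatTrans Ss Ss (functor_id Ss) (functor_comp minus plus) j eta_natural.

Definition epsilon_at (S : signature) : flexible (T S) S :=
  Flat (strict_id (T S)).

Lemma epsilon_natural (S S' : signature) (h : flexible S S') :
  flex_comp (epsilon_at S') (plus_map (ext_restr h)) =
  flex_comp h (epsilon_at S).
Proof. by apply: flexP => n c; exact: ext_j. Qed.

Definition epsilon : nat_trans (functor_comp plus minus) (functor_id Sf) :=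
  @NatTrans Sf Sf (functor_comp plus minus) (functor_id Sf)
    epsilon_at epsilon_natural.

Lemma App_inj (S : signature) n (c c' : S n) psi psi' :
  App c psi = App c' psi' -> c = c'.
Proof.
pose head (phi : formula S) :=
  if phi is App m d _ then Some (Tagged S d) else None.
by move=> /(congr1 head)[e]; exact: (@eq_from_Tagged nat S n c c' e).
Qed.

Lemma plus_faithful : faithful plus.
Proof.
move=> S S' f g fg; apply: strictP => n c.
exact: App_inj (congr1 (fun h : flexible S S' => sval (sharp h c)) fg).
Qed.

Lemma minus_faithful : faithful minus.
Proof.
move=> S S' f g fg; apply: flexP => n c.
rewrite -(ext_j f) -(ext_j g).
by have /(congr1 (fun h : strict _ _ => sval (h n (j c)))) :
  ext_restr f = ext_restr g := fg.
Qed.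

(* Main.v *)
(* The hom-set bijection is the definition of a flexible morphism, f |-> f^sharp,
   so the only computation is naturality on the strict side, where it amounts to
   the extension of f sending c(x_0, ..., x_(n-1)) to f^sharp(c). *)
Require Import Defs.
From mathcomp Require Import all_boot.

(** At [c], the left side extends [f] to [j (u c)], which [ext_j] evaluates. *)
Lemma sharp_plus_comp (S' S S'' : signature) (u : strict S' S)
    (f : flexible S S'') :
  sharp (flex_comp f (plus_map u)) = strict_comp (sharp f) u.
Proof. by apply: strictP => n c; apply: formula_in_eq; exact: ext_j. Qed.

Definition sharp_adjunction : adjunction plus minus :=
  @Adjunction Ss Sf plus minus (@sharp) (@Flat)
    (* Eta for [flexible] is not definitional, hence the match; the other inverse law and naturality
       in the flexible variable hold by conversion. *)
    (fun S S' f => let: Flat g := f return Flat (sharp f) = f in erefl)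
    (fun _ _ _ => erefl) sharp_plus_comp (fun _ _ _ _ _ => erefl).

Theorem theorem1p6 :
  exists adj : adjunction plus minus,
    (forall S : Ss, adj_unit adj S = eta S) /\
    (forall S : Sf, adj_counit adj S = epsilon S).
(* Both identities hold by computation: [sharp (flex_id S)] reduces to [j S], and [Flat] of the
   identity of [T S] is [epsilon_at S]. *)
Proof. by exists sharp_adjunction. Qed.
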